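(* Let $i\ge 0$ and let $S$ be a finite $(i-1)$-acyclic CW-complex with $n$ cells of dimension $i-1$ and $m$ cells of dimension $i$, and let $\partial:=\partial_i\in\mathbb{Z}^{n\times m}$ be its $i$-th cellular boundary matrix (with respect to chosen orientations of the cells). Then $$\operatorname{pdet}(\partial\partial^t)=\tau_{i-1}(S)\cdot\tau_i(S).$$ Moreover, let $\mathbf{x}=(x_1,\dots,x_n)$ and $\mathbf{y}=(y_1,\dots,y_m)$ be indeterminates indexing the $(i-1)$-cells and $i$-cells respectively, $X=\operatorname{diag}(\mathbf{x})$, $Y=\operatorname{diag}(\mathbf{y})$ and $L=X^{1/2}\partial Y\partial^tX^{1/2}$. Then $$\operatorname{pdet}(L)=\mathbf{x}^{[n]}\cdot\tau_{i-1}(S,\mathbf{x}^{-1})\cdot\tau_i(S,\mathbf{y}),$$ where $\mathbf{x}^{[n]}=x_1\cdots x_n$ and $\tau_{i-1}(S,\mathbf{x}^{-1})$ is obtained from $\tau_{i-1}(S,\mathbf{x})$ by substituting $x_j\mapsto x_j^{-1}$.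
   Context: CW-complexes use the augmented integral cellular chain complex $\cdots\to C_i(S)\xrightarrow{\partial_i}C_{i-1}(S)\to\cdots\to C_0(S)\xrightarrow{\partial_0}C_{-1}(S)=\mathbb{Z}\to0$ (one $(-1)$-dimensional empty cell), and $\tilde H_j(S)=\ker\partial_j/\operatorname{im}\partial_{j+1}$ with $\mathbb{Z}$ coefficients. $S^{(i)}$ is the $i$-skeleton. $S$ is $(i-1)$-acyclic if $\tilde H_j(S)=0$ for $-1\le j\le i-1$. For such $S$, a subcomplex $T$ is an $i$-tree if $S^{(i-1)}\subseteq T\subseteq S^{(i)}$ and any two (equivalently all three) of: (i) $\tilde H_i(T)=0$; (ii) $\tilde H_{i-1}(T)$ is finite; (iii) the number of $i$-cells of $T$ equals the rank of $\partial_i$. The torsion tree enumerator is $\tau_i(S)=\sum_{i\text{-trees }T}|\tilde H_{i-1}(T)|^2$, and with variables $\mathbf{x}$ indexing the $i$-cells, the weighted enumerator is $\tau_i(S,\mathbf{x})=\sum_{i\text{-trees }T}\mathbf{x}^T|\tilde H_{i-1}(T)|^2$, where $\mathbf{x}^T$ is the product of the variables of the $i$-cells of $T$. For a square matrix $M$ of rank $s$ over an integral domain, $\operatorname{pdet}(M)=\sum_{|I|=s}\det M_{I,I}$ (sum of principal $s\times s$ minors). *)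

(* Defs.v *)
From HB Require Import structures.
From mathcomp Require Import all_boot all_order all_algebra.
From mathcomp Require mpoly.

Set Implicit Arguments.
Unset Strict Implicit.
Unset Printing Implicit Defensive.

Import Order.TTheory GRing.Theory Num.Theory.
Local Open Scope ring_scope.

(* [mpoly] is imported only inside this module because its notations clash
   with those of the analysis library used below. *)
Module Indeterminates.
Import mpoly.

(* The field Q(X_0, ..., X_(k-1)), as the fraction field of Z[X]. *)
Definition ratfun (k : nat) : fieldType := {fraction {mpoly int[k]}}.

Definition indet (k : nat) (j : 'I_k) : ratfun k :=
  @FracField.tofrac {mpoly int[k]} 'X_j.

End Indeterminates.

Notation ratfun := Indeterminates.ratfun.
Notation indet := Indeterminates.indet.

From mathcomp Require Import finmap all_classical reals topology normedtype trigo.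
Import numFieldNormedType.Exports.
Local Open Scope classical_set_scope.

Section Pseudodeterminant.
Variable A : idomainType.

Definition rank_dom (p q : nat) (M : 'M[A]_(p, q)) : nat :=
  \rank (map_mx (@FracField.tofrac A) M).

Definition pdet (p : nat) (M : 'M[A]_p) : A :=
  \sum_(I : {set 'I_p} | #|I| == rank_dom M)
    \det (mxsub (@enum_val _ (mem I)) (@enum_val _ (mem I)) M).

End Pseudodeterminant.

(* Row vectors carry the product topology; the library norm on them is the sup
   norm, so the Euclidean one is written out. *)
Section Spheres.
Variable R : realType.

Definition sqnorm (k : nat) (x : 'rV[R]_k) : R := \sum_j x 0 j ^+ 2.

Definition disc (k : nat) : set 'rV[R]_k := [set x | sqnorm x <= 1].
Definition open_disc (k : nat) : set 'rV[R]_k := [set x | sqnorm x < 1].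

(* The unit sphere of R^k, of dimension k - 1; it is empty for k = 0. *)
Definition sphere (k : nat) : set 'rV[R]_k := [set x | sqnorm x = 1].

Local Arguments sphere k _ : clear implicits.

(* [pole] is the base point of the sphere of dimension k, and [pinch] induces
   a homeomorphism from disc k / sphere k onto that sphere, sending the class
   of sphere k to [pole]. *)
Definition pole (k : nat) : 'rV[R]_k.+1 := row_mx (1%:M : 'rV[R]_1) 0.

Definition pinch (k : nat) (y : 'rV[R]_k) : 'rV[R]_k.+1 :=
  row_mx ((2 * sqnorm y - 1)%:M : 'rV[R]_1)
         ((2 * Num.sqrt (1 - sqnorm y)) *: y).

Definition sphere_homotopic (k : nat) (f g : 'rV[R]_k -> 'rV[R]_k) : Prop :=
  exists H : R * 'rV[R]_k -> 'rV[R]_k,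
    [/\ {within `[0, 1]%classic `*` sphere k, continuous H},
        forall t x, t \in `[0, 1] -> sphere k x -> sphere k (H (t, x)),
        forall x, sphere k x -> H (0, x) = f x &
        forall x, sphere k x -> H (1, x) = g x].

(* The iterated suspension of z |-> z ^ d on the unit circle, written in polar
   coordinates (r, t) of the first two coordinates. *)
Definition winding (k : nat) (d : int) (g : 'rV[R]_k.+2 -> 'rV[R]_k.+2) : Prop :=
  forall (x : 'rV[R]_k.+2) (r t : R), 0 <= r ->
    x 0 0 = r * cos t -> x 0 1 = r * sin t ->
    g x = \row_j (if j == 0 then r * cos (d%:~R * t)
                  else if j == 1 then r * sin (d%:~R * t) else x 0 j).

(* The degree of a self-map f of the sphere of dimension k.  For k > 0 it is
   the class of f in [S^k, S^k] = Z; for k = 0 it is the effect of f on the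
   reduced homology of {1, -1}, i.e. (f 1 - f (-1)) / 2. *)
Definition has_degree (k : nat) :
    ('rV[R]_k.+1 -> 'rV[R]_k.+1) -> int -> Prop :=
  match k with
  | 0 => fun f d =>
      (f (const_mx 1)) 0 0 - (f (const_mx (- 1))) 0 0 = 2 * d%:~R
  | _.+1 => fun f d => exists2 g, winding d g & sphere_homotopic f g
  end.

End Spheres.

Arguments disc {R} k _.
Arguments open_disc {R} k _.
Arguments sphere {R} k _.
Arguments pole {R} k.

(* Finite CW-complexes, given by characteristic maps, of which only the
   restriction to the closed disc matters.  For finitely many cells the closure
   finiteness and weak topology axioms are automatic, and since the space is
   Hausdorff each characteristic map is a homeomorphism from the open disc onto
   the open cell.  The characteristic maps orient the cells. *)
Record finCW (R : realType) := FinCW {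
  cw_space : topologicalType;
  cw_cell : finType;
  cw_dim : cw_cell -> nat;
  cw_char : forall c : cw_cell, 'rV[R]_(cw_dim c) -> cw_space;
  cw_hausdorff : hausdorff_space cw_space;
  cw_continuous : forall c, {within disc (cw_dim c), continuous (@cw_char c)};
  cw_inj : forall c, {in open_disc (cw_dim c) &, injective (@cw_char c)};
  cw_partition : forall p : cw_space,
        exists! c, (@cw_char c @` open_disc (cw_dim c)) p;
  cw_attach : forall c x, sphere (cw_dim c) x -> exists2 b, (cw_dim b < cw_dim c)%N &
        (@cw_char b @` open_disc (cw_dim b)) (@cw_char c x)
}.

Section Cells.
Variables (R : realType) (S : finCW R).

Definition open_cell (c : cw_cell S) : set (cw_space S) :=
  @cw_char R S c @` open_disc (cw_dim c).

(* The cells together with the empty cell [None], of dimension -1. *)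
Definition acell : finType := option (cw_cell S).

Definition adim (c : acell) : int :=
  if c is Some c' then (cw_dim c')%:Z else - 1.

Definition cells (j : int) : {set acell} := [set c | adim c == j]%SET.

Definition skeleton (j : int) : {set acell} := [set c | adim c <= j]%SET.

(* A subcomplex contains the closure of each of its cells, the empty cell
   counting as a face of every cell.  The void complex, without even the empty
   cell, is allowed: it is the unique (-1)-tree. *)
Definition subcomplex (T : {set acell}) : Prop :=
  forall c : cw_cell S, Some c \in T ->
    None \in T /\
    @cw_char R S c @` disc (cw_dim c) `<=`
      \bigcup_(b in [set b | Some b \in T]) open_cell b.

(* The collapse X^(k) -> X^(k) / (X^(k) - e_b) = S^k, for k = dim b. *)
Definition collapse (b : cw_cell S) (p : cw_space S) : 'rV[R]_(cw_dim b).+1 :=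
  if pselect (open_cell b p) is left h then pinch (s2val (cid2 h)) else pole _.

(* The attaching map of c followed by the collapse onto b. *)
Definition attach (b c : cw_cell S) (e : cw_dim c = (cw_dim b).+1)
    (x : 'rV[R]_(cw_dim b).+1) : 'rV[R]_(cw_dim b).+1 :=
  collapse b (@cw_char R S c (castmx (erefl, esym e) x)).

(* [b : c] extended to the empty cell, which has incidence 1 with every
   vertex; it is only meaningful for adim c = adim b + 1. *)
Definition aincidence (inc : cw_cell S -> cw_cell S -> int) (b c : acell) : int :=
  match b, c with
  | Some b', Some c' => inc b' c'
  | None, Some _ => 1
  | _, None => 0
  end.

(* The matrix with rows indexed by the k-cells and columns by the j-cells; for
   k = j - 1 this is the boundary matrix from C_j to C_(j-1). *)
Definition incidence_mx (inc : cw_cell S -> cw_cell S -> int) (k j : int) :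
    'M[int]_(#|cells k|, #|cells j|) :=
  \matrix_(a, b) aincidence inc (enum_val a) (enum_val b).

(* The augmented cellular chain complex of S.  The incidence numbers are the
   degrees of the maps [attach], hence determined by S in consecutive dimensions
   (the only ones ever used), and the last field, that the boundary squares to
   zero, is a standard consequence of the previous one. *)
Record cellular_chains := CellularChains {
  incidence : cw_cell S -> cw_cell S -> int;
  incidence_degree : forall (b c : cw_cell S) (e : cw_dim c = (cw_dim b).+1),
        has_degree (attach e) (incidence b c);
  incidence_boundary : forall j : int,
        incidence_mx incidence (j - 1) j *m incidence_mx incidence j (j + 1) = 0
}.

End Cells.

Section Trees.
Variables (R : realType) (S : finCW R) (C : cellular_chains S).

Definition boundary_mx (k j : int) : 'M[int]_(#|cells S k|, #|cells S j|) :=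
  incidence_mx (incidence C) k j.

Definition chains (T : {set acell S}) (j : int) : set 'cV[int]_#|cells S j| :=
  [set z : 'cV[int]_#|cells S j| | forall a, z a 0 != 0 -> enum_val a \in T].

Arguments chains T j _ : clear implicits.

Definition cycles (T : {set acell S}) (j : int) : set 'cV[int]_#|cells S j| :=
  [set z : 'cV[int]_#|cells S j| | chains T j z /\ boundary_mx (j - 1) j *m z = 0].

Arguments cycles T j _ : clear implicits.

Definition boundaries (T : {set acell S}) (j : int) :
    set 'cV[int]_#|cells S j| :=
  [set boundary_mx j (j + 1) *m u | u in chains T (j + 1)].

Arguments boundaries T j _ : clear implicits.

(* The reduced homology group, as the set of cosets of the boundaries in the
   cycles. *)
Definition homology (T : {set acell S}) (j : int) :
    set (set 'cV[int]_#|cells S j|) :=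
  [set [set z + w | w in boundaries T j] | z in cycles T j].

Arguments homology T j _ : clear implicits.

Definition homology0 (T : {set acell S}) (j : int) : Prop :=
  homology T j = [set boundaries T j].

(* Only meaningful when the homology group is finite. *)
Definition homology_card (T : {set acell S}) (j : int) : nat :=
  (#|` fset_set (homology T j)|)%fset.

Definition acyclic (j : int) : Prop :=
  forall k : int, - 1 <= k <= j -> homology0 [set: acell S]%SET k.

Definition is_tree (j : int) (T : {set acell S}) : Prop :=
  [/\ subcomplex T,
      skeleton S (j - 1) \subset T,
      T \subset skeleton S j &
      let P1 := homology0 T j in
      let P2 := finite_set (homology T (j - 1)) in
      let P3 := #|T :&: cells S j| = rank_dom (boundary_mx (j - 1) j) in
      [\/ P1 /\ P2, P1 /\ P3 | P2 /\ P3]].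

Definition tree_enum (j : int) : nat :=
  (\sum_(T : {set acell S} | `[< is_tree j T >])
     homology_card T (j - 1)%R ^ 2)%N.

(* The weighted enumerator evaluated at weights w of the j-cells. *)
Definition wtree_enum (j : int) (A : comNzRingType) (w : 'rV[A]_#|cells S j|) : A :=
  \sum_(T : {set acell S} | `[< is_tree j T >])
    (\prod_(a | enum_val a \in T) w 0 a) *
    (homology_card T (j - 1)%R ^ 2)%N%:R.

End Trees.

Arguments chains {R S} T j _.
Arguments cycles {R S} C T j _.
Arguments boundaries {R S} C T j _.
Arguments homology {R S} C T j _.
Arguments wtree_enum {R S} C j {A} w.

(* Main.v *)
(** Write [A] and [D] for the boundary matrices in degrees [i - 1] and [i], and
    [r] for the rank of [D].  By Cauchy-Binet, the principal [r]-minor of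
    [L = X^(1/2) D Y D^T X^(1/2)] on the rows [I] is, up to the weights, the sum
    over the [r]-sets of columns [J] of the squared minors of [D] on [I] and
    [J].  Since [ker A = im D], such a minor is nonzero exactly when [J] is a
    column basis of [D] and the complement of [I] is one of [A], that is, when
    [J] spans an [i]-tree and the complement of [I] an [(i-1)]-tree.  In that
    case its absolute value is the index of [D_I Z^J] in [Z^I], which factors
    through the lattice [D_I Z^m] into the orders of the homology groups
    [ker A / D Z^J] and [A Z^n / A Z^(~I)] of the two trees.

    That [L] has rank [r] is seen by specializing the indeterminates to [1],
    which turns its principal minors into sums of squares of integers; the
    unweighted identity is the case of all weights equal to [1]. *)

Require Import Defs.
From HB Require Import structures.
From mathcomp Require Import all_boot all_order all_algebra fingroup perm.
From mathcomp Require mpoly.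

Set Implicit Arguments.
Unset Strict Implicit.
Unset Printing Implicit Defensive.

Import Order.TTheory GRing.Theory Num.Theory.
Local Open Scope ring_scope.

(** * Minors and the Cauchy-Binet formula *)

Definition enum_cast r q (J : {set 'I_q}) (e : r = #|J|) (k : 'I_r) : 'I_q :=
  enum_val (cast_ord e k).

Section EnumCast.
Variables (r q : nat) (J : {set 'I_q}) (e : r = #|J|).

Lemma enum_castP k : enum_cast e k \in J.
Proof. exact: enum_valP. Qed.

Lemma enum_cast_inj : injective (enum_cast e).
Proof. by move=> k l /enum_val_inj/cast_ord_inj. Qed.

Lemma enum_cast_onto j : j \in J -> exists k, enum_cast e k = j.
Proof.
move=> jJ; exists (cast_ord (esym e) (enum_rank_in jJ j)).
by rewrite /enum_cast cast_ordKV enum_rankK_in.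
Qed.

Lemma enum_cast_perm (f : 'I_r -> 'I_q) :
    injective f -> (forall k, f k \in J) ->
  exists s : 'S_r, forall k, f k = enum_cast e (s k).
Proof.
move=> f_inj fJ; have [t ft] := fin_all_exists (fun k => enum_cast_onto (fJ k)).
have t_inj : injective t by move=> k l tkl; apply: f_inj; rewrite -!ft tkl.
by exists (perm t_inj) => k; rewrite permE ft.
Qed.

Lemma big_enum_cast (T : Type) (idx : T) (op : Monoid.com_law idx)
    (F : 'I_q -> T) :
  \big[op/idx]_(j in J) F j = \big[op/idx]_(k < r) F (enum_cast e k).
Proof.
rewrite big_enum_val (reindex (cast_ord e)) //; apply: onW_bij.
by exists (cast_ord (esym e)); [apply: cast_ordK | apply: cast_ordKV].
Qed.

End EnumCast.

Section Minors.
Variable R : comNzRingType.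

(* The value is [0] when [I] and [J] differ in size. *)
Definition minor p q (I : {set 'I_p}) (J : {set 'I_q}) (M : 'M[R]_(p, q)) : R :=
  if #|I| =P #|J| is ReflectT e
  then \det (mxsub (enum_cast erefl) (enum_cast e) M) else 0.

Lemma minorE p q r (I : {set 'I_p}) (J : {set 'I_q}) (M : 'M[R]_(p, q))
    (eI : r = #|I|) (eJ : r = #|J|) :
  minor I J M = \det (mxsub (enum_cast eI) (enum_cast eJ) M).
Proof.
subst r; rewrite /minor; case: eqP => // e.
by rewrite (eq_irrelevance e eJ).
Qed.

Lemma minor_card_eq p q (I : {set 'I_p}) (J : {set 'I_q}) (M : 'M[R]_(p, q)) :
  minor I J M != 0 -> #|I| = #|J|.
Proof. by rewrite /minor; case: eqP => // _; rewrite eqxx. Qed.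

Lemma minor_tr p q (I : {set 'I_p}) (J : {set 'I_q}) (M : 'M[R]_(p, q)) :
  minor J I M^T = minor I J M.
Proof.
rewrite [RHS]/minor; case: eqP => [e|ne].
  by rewrite (minorE _ e erefl) -trmx_mxsub det_tr.
by rewrite /minor; case: eqP => // e; case: ne.
Qed.

Lemma mxsub_mul_diag p q r (f : 'I_r -> 'I_p) (g : 'I_r -> 'I_q)
    (M : 'M[R]_(p, q)) (d : 'rV[R]_q) :
  mxsub f g M *m diag_mx (colsub g d) = mxsub f g (M *m diag_mx d).
Proof. by apply/matrixP => k l; rewrite [RHS]mxE !mul_mx_diag !mxE. Qed.

Lemma minor_mul_diag p q (I : {set 'I_p}) (J : {set 'I_q}) (M : 'M[R]_(p, q))
    (d : 'rV[R]_q) :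
  minor I J (M *m diag_mx d) = minor I J M * \prod_(j in J) d 0 j.
Proof.
rewrite /minor; case: eqP => [e|_]; last by rewrite mul0r.
rewrite (big_enum_cast e) -mxsub_mul_diag det_mulmx det_diag.
by congr (_ * _); apply: eq_bigr => k _; rewrite mxE.
Qed.

Lemma minor_diag_mul p q (I : {set 'I_p}) (J : {set 'I_q}) (M : 'M[R]_(p, q))
    (d : 'rV[R]_p) :
  minor I J (diag_mx d *m M) = (\prod_(i in I) d 0 i) * minor I J M.
Proof.
by rewrite -minor_tr trmx_mul tr_diag_mx minor_mul_diag minor_tr mulrC.
Qed.

Lemma det_mxsub_imset p q r (M : 'M[R]_(p, q)) (f : 'I_r -> 'I_p)
    (g : 'I_r -> 'I_q) :
    injective f -> injective g ->
  exists b : bool,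
    \det (mxsub f g M) =
      (-1) ^+ b * minor [set f k | k : 'I_r] [set g k | k : 'I_r] M.
Proof.
move=> f_inj g_inj; set I := [set f k | k : _]; set J := [set g k | k : _].
have eI : r = #|I| by rewrite card_imset // card_ord.
have eJ : r = #|J| by rewrite card_imset // card_ord.
have [|s fs] := enum_cast_perm eI f_inj; first by move=> k; rewrite imset_f.
have [|t gt] := enum_cast_perm eJ g_inj; first by move=> k; rewrite imset_f.
exists (odd_perm s (+) odd_perm t); rewrite (minorE _ eI eJ).
set N := mxsub (enum_cast eI) _ _.
have -> : mxsub f g M = row_perm s (col_perm t N).
  by apply/matrixP => k l; rewrite !mxE fs gt.
rewrite row_permE col_permE !det_mulmx !det_perm odd_permV signr_addb.
by rewrite -mulrA [\det N * _]mulrC.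
Qed.

Lemma det_mulmx_ffun p q (M : 'M[R]_(p, q)) (N : 'M[R]_(q, p)) :
  \det (M *m N) =
    \sum_(f : {ffun 'I_p -> 'I_q}) (\prod_i M i (f i)) * \det (rowsub f N).
Proof.
rewrite /determinant.
under eq_bigr => s _.
  under eq_bigr do rewrite mxE.
  rewrite bigA_distr_bigA big_distrr /=; over.
rewrite exchange_big /=; apply: eq_bigr => f _.
rewrite big_distrr /=; apply: eq_bigr => s _.
rewrite big_split /= mulrCA; congr (_ * (_ * _)).
by apply: eq_bigr => i _; rewrite !mxE.
Qed.

Lemma sum_ffun_imset p q (M : 'M[R]_(p, q)) (N : 'M[R]_(q, p))
    (J : {set 'I_q}) (e : p = #|J|) :
  \sum_(f : {ffun 'I_p -> 'I_q} | injectiveb f && ([set f i | i : 'I_p] == J))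
     (\prod_i M i (f i)) * \det (rowsub f N) =
  \det (colsub (enum_cast e) M) * \det (rowsub (enum_cast e) N).
Proof.
pose g (s : 'S_p) : {ffun 'I_p -> 'I_q} := [ffun i => enum_cast e (s i)].
have g_inj : injective g.
  move=> s t /ffunP st; apply/permP => i; have := st i; rewrite !ffunE.
  exact: enum_cast_inj.
rewrite (eq_bigl (fun f => f \in [set g s | s in [set: 'S_p]])); last first.
  move=> f; apply/andP/imsetP => [[/injectiveP f_inj /eqP fJ]|[s _ ->]].
    have [|s fs] := enum_cast_perm e f_inj.
      by move=> i; rewrite -fJ imset_f.
    by exists s => //; apply/ffunP => i; rewrite ffunE.
  have gs_inj : injective (g s).
    by move=> i j; rewrite !ffunE => /enum_cast_inj/perm_inj.
  split; first exact/injectiveP.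
  rewrite eqEcard card_imset // card_ord -e leqnn andbT.
  by apply/subsetP => _ /imsetP[i _ ->]; rewrite ffunE enum_castP.
rewrite big_imset /=; last by move=> s t _ _ /g_inj.
rewrite [\det (colsub _ M)]/determinant mulr_suml.
apply: eq_big => [s|s _]; first by rewrite inE.
have -> : rowsub (g s) N = row_perm s (rowsub (enum_cast e) N).
  by apply/matrixP => i j; rewrite !mxE ffunE.
rewrite row_permE det_mulmx det_perm mulrA [_ * (-1) ^+ s]mulrC.
by congr (_ * _ * _); apply: eq_bigr => i _; rewrite !mxE ffunE.
Qed.

Lemma cauchy_binet p q r (I : {set 'I_p}) (K : {set 'I_r}) (M : 'M[R]_(p, q))
    (N : 'M[R]_(q, r)) :
  minor I K (M *m N) =
    \sum_(J : {set 'I_q} | #|J| == #|I|) minor I J M * minor J K N.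
Proof.
case: (#|I| =P #|K|) => [e|neIK]; last first.
  rewrite big1 => [|J /eqP JI]; rewrite /minor; first by case: eqP.
  by case: (#|J| =P #|K|) => [JK|]; [case: neIK; rewrite -JI | rewrite mulr0].
rewrite (minorE _ erefl e) mxsub_mul det_mulmx_ffun.
rewrite (bigID (fun f : {ffun _} => injectiveb f)) /= [X in _ + X]big1 ?addr0.
  rewrite (partition_big (fun f : {ffun _ -> 'I_q} => [set f i | i : 'I_#|I|])
    (fun J : {set 'I_q} => #|J| == #|I|)) /=; last first.
    by move=> f /injectiveP f_inj; rewrite card_imset // card_ord.
  apply: eq_bigr => J /eqP/esym eJ; rewrite (sum_ffun_imset _ _ eJ).
  by rewrite -mxsubcr -mxsubrc -!minorE.
move=> f /injectivePn[i [j ij fij]].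
by rewrite (determinant_alternate ij) ?mulr0 // => k; rewrite !mxE fij.
Qed.

End Minors.

Lemma minor_map (R R' : comNzRingType) (f : {rmorphism R -> R'}) p q
    (I : {set 'I_p}) (J : {set 'I_q}) (M : 'M[R]_(p, q)) :
  minor I J (map_mx f M) = f (minor I J M).
Proof.
rewrite /minor; case: eqP => [e|_]; last by rewrite rmorph0.
by rewrite -det_map_mx map_mxsub.
Qed.

Lemma pdetE (A : idomainType) p (M : 'M[A]_p) :
  pdet M = \sum_(I : {set 'I_p} | #|I| == rank_dom M) minor I I M.
Proof.
apply: eq_bigr => I _; rewrite (minorE _ erefl erefl); congr (\det _).
by apply/matrixP => k l; rewrite !mxE /enum_cast !cast_ord_id.
Qed.

(** * Rank over an integral domain *)

Lemma mxrank_mxsub (F : fieldType) p q p' q' (f : 'I_p' -> 'I_p)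
    (g : 'I_q' -> 'I_q) (M : 'M[F]_(p, q)) :
  (\rank (mxsub f g M) <= \rank M)%N.
Proof.
rewrite mxsubrc (leq_trans (mxrankS (rowsub_sub _ _))) //.
by rewrite -mxrank_tr trmx_mxsub -[leqRHS]mxrank_tr mxrankS ?rowsub_sub.
Qed.

Section RankDom.
Variable A : idomainType.
Local Notation toF := (map_mx (@FracField.tofrac A)).

Lemma map_tofrac_eq0 p q (M : 'M[A]_(p, q)) : (toF M == 0) = (M == 0).
Proof.
apply/eqP/eqP => [/matrixP M0|->]; last exact: map_mx0.
by apply/matrixP => i j; have /eqP := M0 i j; rewrite !mxE tofrac_eq0 => /eqP.
Qed.

Lemma rank_dom_tr p q (M : 'M[A]_(p, q)) : rank_dom M^T = rank_dom M.
Proof. by rewrite /rank_dom -map_trmx mxrank_tr. Qed.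

Lemma rank_dom_mxsub p q p' q' (f : 'I_p' -> 'I_p) (g : 'I_q' -> 'I_q)
    (M : 'M[A]_(p, q)) :
  (rank_dom (mxsub f g M) <= rank_dom M)%N.
Proof. by rewrite /rank_dom map_mxsub mxrank_mxsub. Qed.

Lemma rank_domM_maxl p q r (M : 'M[A]_(p, q)) (N : 'M[A]_(q, r)) :
  (rank_dom (M *m N) <= rank_dom M)%N.
Proof. by rewrite /rank_dom map_mxM mxrankM_maxl. Qed.

Lemma rank_domM_maxr p q r (M : 'M[A]_(p, q)) (N : 'M[A]_(q, r)) :
  (rank_dom (M *m N) <= rank_dom N)%N.
Proof. by rewrite /rank_dom map_mxM mxrankM_maxr. Qed.

Lemma rank_dom_det r (M : 'M[A]_r) : (rank_dom M == r) = (\det M != 0).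
Proof.
rewrite -[LHS]/(row_free (toF M)) row_free_unit unitmxE unitfE det_map_mx.
by rewrite tofrac_eq0.
Qed.

Lemma minor_neq0_leq_rank p q (I : {set 'I_p}) (J : {set 'I_q})
    (M : 'M[A]_(p, q)) :
  minor I J M != 0 -> (#|I| <= rank_dom M)%N.
Proof.
move=> M0; move: (M0); rewrite (minorE _ erefl (minor_card_eq M0)).
by rewrite -rank_dom_det => /eqP {1}<-; apply: rank_dom_mxsub.
Qed.

Lemma exists_minor_neq0 p q (M : 'M[A]_(p, q)) :
  exists (I : {set 'I_p}) (J : {set 'I_q}),
    #|I| = rank_dom M /\ minor I J M != 0.
Proof.
pose f := maxrankfun (toF M).
have full : row_full (rowsub f (toF M))^T.
  by rewrite /row_full mxrank_tr; apply: maxrowsub_free.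
pose g := fullrankfun full.
have f_inj : injective f by apply: maxrankfun_inj.
have g_inj : injective g by apply: fullrankfun_inj.
exists [set f i | i : 'I_(rank_dom M)], [set g i | i : 'I_(rank_dom M)].
split; first by rewrite card_imset // card_ord.
have := fullrowsub_unit full; rewrite -/g -unitmx_tr trmx_mxsub -mxsubrc.
rewrite trmx_mxsub trmxK -map_mxsub unitmxE unitfE det_map_mx tofrac_eq0.
have [b ->] := det_mxsub_imset M f_inj g_inj.
by rewrite mulf_eq0 signr_eq0.
Qed.

Lemma frac_numden (x : {fraction A}) : exists nd : A * A,
  nd.2 != 0 /\ FracField.tofrac nd.1 = FracField.tofrac nd.2 * x.
Proof.
elim/quotW: x => x; exists (frac x); split; first exact: denom_ratioP.
unlock FracField.tofrac; rewrite -[RHS]FracField.pi_mul.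
apply/eqmodP; rewrite /= FracField.equivfE /FracField.mulf.
by rewrite !numden_Ratio ?oner_neq0 ?mul1r ?denom_ratioP // mulrC.
Qed.

Lemma clear_denominators p q (M : 'M[{fraction A}]_(p, q)) :
  exists (c : A) (N : 'M[A]_(p, q)), c != 0 /\ toF N = FracField.tofrac c *: M.
Proof.
have [nd ndM] :=
  fin_all_exists (fun k : 'I_p * 'I_q => frac_numden (M k.1 k.2)).
exists (\prod_k (nd k).2),
  (\matrix_(i, j) ((nd (i, j)).1 * \prod_(k | k != (i, j)) (nd k).2)); split.
  by apply/prodf_neq0 => k _; case: (ndM k).
apply/matrixP => i j; rewrite !mxE [in RHS](bigD1 (i, j)) //= !rmorphM /=.
by rewrite (ndM (i, j)).2 mulrAC.
Qed.

Lemma clear_denominators_ker p q (M : 'M[A]_(p, q)) (v : 'cV[{fraction A}]_q) :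
    toF M *m v = 0 ->
  exists (c : A) (u : 'cV[A]_q),
    [/\ c != 0, M *m u = 0 & toF u = FracField.tofrac c *: v].
Proof.
have [c [u [c0 uv]]] := clear_denominators v => Mv.
exists c, u; split=> //; apply/eqP; rewrite -map_tofrac_eq0 map_mxM uv.
by rewrite -scalemxAr Mv scaler0.
Qed.

Lemma rank_dom_injP p q (M : 'M[A]_(p, q)) :
  (forall u : 'cV_q, M *m u = 0 -> u = 0) <-> rank_dom M = q.
Proof.
rewrite -rank_dom_tr /rank_dom -map_trmx; split=> [inj|/eqP free u Mu].
  apply/eqP/inj_row_free => v vM; apply: trmx_inj; rewrite trmx0.
  have [|c [u [c0 /inj u0 uv]]] := @clear_denominators_ker _ _ M v^T.
    by apply: trmx_inj; rewrite trmx_mul trmxK trmx0.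
  apply/eqP; move/eqP: uv; rewrite u0 map_mx0 eq_sym scaler_eq0 tofrac_eq0.
  by rewrite (negPf c0).
apply/eqP; rewrite -map_tofrac_eq0 -trmx_eq0 -(mulmx_free_eq0 _ free).
by rewrite -trmx_mul -map_mxM Mu map_mx0 trmx0.
Qed.

Lemma rowsub_mul_eq0 p q r (f : 'I_r -> 'I_p) (M : 'M[A]_(p, q)) (u : 'cV_q) :
  rank_dom (rowsub f M) = rank_dom M -> rowsub f (M *m u) = 0 -> M *m u = 0.
Proof.
rewrite /rank_dom map_mxsub => rf fu.
have [_] := mxrank_leqif_sup (rowsub_sub f (toF M)).
rewrite rf eqxx => /esym/submxP[Q MQ]; apply/eqP.
rewrite -map_tofrac_eq0 map_mxM MQ.
by rewrite -mulmxA -map_mxsub -map_mxM mul_rowsub_mx fu map_mx0 mulmx0.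
Qed.

End RankDom.

Lemma rank_dom_map (A B : idomainType) (f : {rmorphism A -> B}) p q
    (M : 'M[A]_(p, q)) :
  (rank_dom (map_mx f M) <= rank_dom M)%N.
Proof.
have [I [J [<- fM0]]] := exists_minor_neq0 (map_mx f M).
apply: (@minor_neq0_leq_rank _ _ _ _ J); apply: contraNneq fM0 => M0.
by rewrite minor_map M0 rmorph0.
Qed.

(** * Weighted Gram matrices *)

Section WeightedGram.
Variables (R : comNzRingType) (n m : nat).
Implicit Types (x s : 'rV[R]_n) (y : 'rV[R]_m) (M : 'M[R]_(n, m)).

Definition weighted_gram s y M : 'M[R]_n :=
  diag_mx s *m M *m diag_mx y *m M^T *m diag_mx s.

Definition gram_minor x y (I : {set 'I_n}) M : R :=
  (\prod_(i in I) x 0 i) *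
    \sum_(J : {set 'I_m} | #|J| == #|I|)
      (\prod_(j in J) y 0 j) * minor I J M ^+ 2.

Lemma minor_weighted_gram x s y I M : (forall i, s 0 i ^+ 2 = x 0 i) ->
  minor I I (weighted_gram s y M) = gram_minor x y I M.
Proof.
move=> sx; rewrite /weighted_gram minor_mul_diag -!mulmxA minor_diag_mul mulrAC.
rewrite -big_split mulmxA cauchy_binet; congr (_ * _).
  by apply: eq_bigr => i _; rewrite -sx.
by apply: eq_bigr => J _; rewrite minor_mul_diag minor_tr mulrAC mulrC expr2.
Qed.

End WeightedGram.

Lemma rmorph_gram_minor (R R' : comNzRingType) (f : {rmorphism R -> R'}) n m
    (x : 'rV[R]_n) (y : 'rV[R]_m) I (M : 'M[R]_(n, m)) :
  f (gram_minor x y I M) =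
  gram_minor (map_mx f x) (map_mx f y) I (map_mx f M).
Proof.
rewrite rmorphM rmorph_prod rmorph_sum /gram_minor; congr (_ * _).
  by apply: eq_bigr => i _; rewrite mxE.
apply: eq_bigr => J _; rewrite rmorphM rmorph_prod rmorphXn minor_map.
by congr (_ * _); apply: eq_bigr => j _; rewrite mxE.
Qed.

Lemma gram_minor1_neq0 (R : realDomainType) n m (M : 'M[R]_(n, m)) I J :
  minor I J M != 0 -> gram_minor (const_mx 1) (const_mx 1) I M != 0.
Proof.
move=> M0; rewrite /gram_minor big1 ?mul1r => [|i _]; last by rewrite mxE.
under eq_bigr do under eq_bigr do rewrite mxE.
rewrite psumr_neq0 => [|K _]; last by rewrite big1_eq mul1r sqr_ge0.
apply/hasP; exists J; first exact: mem_index_enum.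
by rewrite big1_eq mul1r exprn_even_gt0 // M0 (minor_card_eq M0) eqxx.
Qed.

Lemma rank_dom_weighted_gram (A B : idomainType) (f : {rmorphism A -> B}) n m
    (s : 'rV[B]_n) (y : 'rV[B]_m) (M : 'M[A]_(n, m)) :
    (forall I J, minor I J M != 0 ->
       minor I I (weighted_gram s y (map_mx f M)) != 0) ->
  rank_dom (weighted_gram s y (map_mx f M)) = rank_dom M.
Proof.
move=> gram_neq0; apply/eqP; rewrite eqn_leq; apply/andP; split.
  rewrite /weighted_gram -3!mulmxA (leq_trans (rank_domM_maxr _ _)) //.
  by rewrite (leq_trans (rank_domM_maxl _ _)) // rank_dom_map.
have [I [J [<- /gram_neq0]]] := exists_minor_neq0 M.
exact: minor_neq0_leq_rank.
Qed.

(* The notations of [mpoly] clash with those of the analysis library, so it is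
   imported locally, before the latter. *)
Module IndeterminateWeights.
Import mpoly.

Section Specialization.
Variables (k : nat) (F : fieldType) (iota : {rmorphism ratfun k -> F}).

Lemma iota_tofrac_neq0 (P : {mpoly int[k]}) :
  P.@[fun=> 1] != 0 -> iota (FracField.tofrac P) != 0.
Proof.
move=> P1; rewrite fmorph_eq0 tofrac_eq0.
by apply: contraNneq P1 => ->; rewrite meval0.
Qed.

Lemma iota_indet_neq0 (j : 'I_k) : iota (indet j) != 0.
Proof. by apply: iota_tofrac_neq0; rewrite mevalXU. Qed.

Lemma gram_minor_indet_neq0 n m (f : 'I_n -> 'I_k) (g : 'I_m -> 'I_k)
    (M : 'M[int]_(n, m)) I J :
    minor I J M != 0 ->
  gram_minor (\row_i iota (indet (f i))) (\row_j iota (indet (g j))) I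
    (map_mx intr M) != 0.
Proof.
pose P : {mpoly int[k]} :=
  gram_minor (\row_i 'X_(f i)) (\row_j 'X_(g j)) I (map_mx intr M).
have -> : gram_minor (\row_i iota (indet (f i))) (\row_j iota (indet (g j))) I
    (map_mx intr M) = iota (FracField.tofrac P).
  rewrite !rmorph_gram_minor; congr gram_minor; apply/matrixP => i j;
  by rewrite !mxE ?rmorph_int.
move=> /gram_minor1_neq0 M1; apply: iota_tofrac_neq0.
rewrite /P rmorph_gram_minor; move: M1; congr (gram_minor _ _ _ _ != 0).
- by apply/matrixP => i j; rewrite !mxE /= mevalXU.
- by apply/matrixP => i j; rewrite !mxE /= mevalXU.
- by apply/matrixP => i j; rewrite !mxE rmorph_int intz.
Qed.

End Specialization.

End IndeterminateWeights.

From mathcomp Require Import finmap.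
From mathcomp Require Import all_classical reals topology normedtype trigo.

Local Open Scope classical_set_scope.
Local Open Scope card_scope.

(** * Cosets and indices *)

Lemma cardfsM (T U : choiceType) (A : {fset T}) (B : {fset U}) :
  #|` (A `*` B)%fset| = (#|` A| * #|` B|)%N.
Proof.
rewrite -(size_allpairs pair A B); apply/perm_size/uniq_perm => [||[x y]].
- exact: fset_uniq.
- by apply: allpairs_uniq => //; [exact: fset_uniq.. | move=> [? ?] [? ?]].
- rewrite in_fsetM; apply/andP/allpairsP => [[xA yB]|]; first by exists (x, y).
  by move=> [[a b] [aA bB [-> ->]]].
Qed.

Lemma fset_set_infinite (T : choiceType) (A : set T) :
  infinite_set A -> fset_set A = finmap.fset0.
Proof. by rewrite /fset_set; case: pselect. Qed.

Lemma card_fset_setX (T U : choiceType) (A : set T) (B : set U) :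
  #|` fset_set (A `*` B)| = (#|` fset_set A| * #|` fset_set B|)%N.
Proof.
have [->|/set0P[a Aa]] := eqVneq A classical_sets.set0.
  by rewrite set0X !fset_set0 !cardfs0.
have [->|/set0P[b Bb]] := eqVneq B classical_sets.set0.
  by rewrite setX0 !fset_set0 !cardfs0 muln0.
have [finA|infA] := pselect (finite_set A); last first.
  rewrite [fset_set A]fset_set_infinite // fset_set_infinite ?cardfs0 //.
  move=> /(finite_image fst); apply: contra_not infA; apply: sub_finite_set.
  by move=> x Ax; exists (x, b).
have [finB|infB] := pselect (finite_set B); last first.
  rewrite [fset_set B]fset_set_infinite // fset_set_infinite ?cardfs0 ?muln0 //.
  move=> /(finite_image snd); apply: contra_not infB; apply: sub_finite_set.
  by move=> y By; exists (a, y).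
by rewrite fset_setX // cardfsM.
Qed.

Lemma card_eq_fset_set (T U : choiceType) (A : set T) (B : set U) :
  A #= B -> #|` fset_set A| = #|` fset_set B|.
Proof.
move=> AB; have finAB := eq_finite_set AB.
have [finA|infA] := pselect (finite_set A).
  by apply/fcard_eq; rewrite -?finAB.
by rewrite !fset_set_infinite // -finAB.
Qed.

Section Cosets.
Variable V : zmodType.
Implicit Types (B M Z : set V) (x y z : V).

Definition subgroup B : Prop := B 0 /\ forall x y, B x -> B y -> B (x - y).

Lemma subgroupT : subgroup setT.
Proof. by []. Qed.

Lemma subgroupN B x : subgroup B -> B x -> B (- x).
Proof. by move=> [B0 BB] Bx; rewrite -sub0r; apply: BB. Qed.

Lemma subgroupD B x y : subgroup B -> B x -> B y -> B (x + y).
Proof.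
by move=> sB Bx By; rewrite -[y]opprK; apply: sB.2 => //; apply: subgroupN.
Qed.

Lemma subgroup_add B M :
  subgroup B -> subgroup M -> subgroup [set x + y | x in B & y in M].
Proof.
move=> sB sM; split=> [|_ _ [x Bx [y My <-]] [x' Bx' [y' My' <-]]].
  by exists 0; [exact: sB.1 | exists 0; rewrite ?addr0 //; exact: sM.1].
exists (x - x'); first exact: sB.2.
by exists (y - y'); [exact: sM.2 | rewrite opprD addrACA].
Qed.

Definition coset B x : set V := [set x + w | w in B].

Definition cosets Z B : set (set V) := [set coset B z | z in Z].

(* The value is [0] when the index is infinite. *)
Definition coset_index Z B : nat := #|` fset_set (cosets Z B)|.

Lemma mem_coset B x y : coset B x y <-> B (y - x).
Proof.
split=> [[w Bw <-]|Byx]; first by rewrite addrAC subrr add0r.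
by exists (y - x); rewrite // addrC subrK.
Qed.

Lemma coset_refl B x : subgroup B -> coset B x x.
Proof. by move=> [B0 _]; apply/mem_coset; rewrite subrr. Qed.

Lemma eq_coset B x y : subgroup B -> coset B x = coset B y <-> B (x - y).
Proof.
move=> sB; split=> [exy|Bxy].
  by apply/mem_coset; rewrite -exy; apply: coset_refl.
apply/seteqP; split=> z /mem_coset Bz; apply/mem_coset.
  by rewrite -(subrKA x); apply: subgroupD.
by rewrite -(subrKA y) -[y - x]opprB; apply: sB.2.
Qed.

Lemma coset0 B : coset B 0 = B.
Proof. by apply/seteqP; split=> x; rewrite mem_coset subr0. Qed.

Lemma coset_id B x : subgroup B -> coset B x = B <-> B x.
Proof.
by move=> sB; rewrite -[X in _ = X]coset0 (eq_coset _ _ sB) subr0.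
Qed.

Lemma image_addr_coset B x y : [set x + w | w in coset B y] = coset B (x + y).
Proof.
apply/seteqP; split=> [_ [_ [w Bw <-] <-]|_ [w Bw <-]].
  by exists w; rewrite // addrA.
by exists (y + w); rewrite ?addrA //; exists w.
Qed.

(* A coset of [B] in [Z] is [c + d], where [c] is the chosen representative of
   a coset of [M] in [Z] and [d] is a coset of [B] in [M]. *)
Lemma cosets_tower Z M B :
    subgroup Z -> subgroup M -> subgroup B -> B `<=` M -> M `<=` Z ->
  cosets Z B #= cosets Z M `*` cosets M B.
Proof.
move=> sZ sM sB BM MZ; pose rep (c : set V) := xget 0 (Z `&` c).
have repP z : Z z ->
    Z (rep (coset M z)) /\ coset M z = coset M (rep (coset M z)).
  move=> Zz; have : (Z `&` coset M z) z by split=> //; apply: coset_refl.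
  move=> /(xgetI 0)[Zr /mem_coset Mr]; split=> //.
  by apply/eq_coset => //; rewrite -opprB; apply: subgroupN.
pose shift (cd : set V * set V) := [set rep cd.1 + w | w in cd.2].
have -> : cosets Z B = shift @` (cosets Z M `*` cosets M B).
  apply/seteqP; split=> [_ [z Zz <-]|_ [[_ _] [/= [z Zz <-] [y My <-]] <-]];
    have [Zr /(eq_coset _ _ sM) Mr] := repP z Zz.
    exists (coset M z, coset B (z - rep (coset M z))).
      by split=> /=; [exists z | exists (z - rep (coset M z)); first exact: Mr].
    by rewrite /shift image_addr_coset addrC subrK.
  rewrite /shift image_addr_coset; eexists; last reflexivity.
  by apply: subgroupD => //; apply: MZ.
apply: inj_card_eq => -[c d] [c' d'].
move=> /set_mem[/= [z Zz <-] [y My <-]] /set_mem[/= [z' Zz' <-] [y' My' <-]].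
rewrite /shift !image_addr_coset => /(eq_coset _ _ sB).
rewrite opprD addrACA => Bd.
have zz' : coset M z = coset M z'.
  rewrite (repP z Zz).2 (repP z' Zz').2; apply/eq_coset => //.
  by have := sM.2 _ _ (BM _ Bd) (sM.2 _ _ My My'); rewrite addrK.
congr (_, _) => //; apply/eq_coset => //.
by move: Bd; rewrite zz' subrr add0r.
Qed.

Lemma coset_index_tower Z M B :
    subgroup Z -> subgroup M -> subgroup B -> B `<=` M -> M `<=` Z ->
  coset_index Z B = (coset_index Z M * coset_index M B)%N.
Proof.
move=> sZ sM sB BM MZ; rewrite -card_fset_setX; apply: card_eq_fset_set.
exact: cosets_tower.
Qed.

Lemma finite_cosets_mulrn Z B x :
    subgroup B -> finite_set (cosets Z B) -> (forall k, Z (x *+ k)) ->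
  exists2 k, (0 < k)%N & B (x *+ k).
Proof.
move=> sB finZB Zx; apply: contrapT => noB; apply: infinite_nat.
have inj_mul : {in [set: nat] &, injective (fun k => coset B (x *+ k))}.
  suff lt_neq k l : (k < l)%N -> coset B (x *+ k) <> coset B (x *+ l).
    by move=> k l _ _ ekl; case: (ltngtP k l) => // /lt_neq; rewrite ekl.
  move=> kl /esym/(eq_coset _ _ sB); rewrite -mulrnBr ?(ltnW kl) // => Bx.
  by apply: noB; exists (l - k)%N; rewrite ?subn_gt0.
rewrite -(eq_finite_set (inj_card_eq inj_mul)).
by apply: sub_finite_set finZB => _ [k _ <-]; exists (x *+ k).
Qed.

End Cosets.

Section CosetImage.
Variables (V W : zmodType) (f : {additive V -> W}).
Implicit Types Z B : set V.

Definition ker_set : set V := f @^-1` [set 0].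

Lemma subgroup_ker : subgroup ker_set.
Proof.
split=> [|x y]; rewrite /ker_set /= ?raddf0 // raddfB => -> ->.
by rewrite subrr.
Qed.

Lemma subgroup_image B : subgroup B -> subgroup (f @` B).
Proof.
move=> sB; split; first by exists 0; [exact: sB.1 | rewrite raddf0].
move=> _ _ [x Bx <-] [y By <-].
by exists (x - y); [exact: sB.2 | rewrite raddfB].
Qed.

Lemma image_coset B x : f @` coset B x = coset (f @` B) (f x).
Proof.
apply/seteqP; split=> [_ [_ [w Bw <-] <-]|_ [_ [w Bw <-] <-]].
  by exists (f w); [exists w | rewrite raddfD].
by exists (x + w); [exists w | rewrite raddfD].
Qed.

Lemma cosets_image Z B :
    subgroup Z -> subgroup B -> B `<=` Z -> Z `&` ker_set `<=` B ->
  cosets (f @` Z) (f @` B) #= cosets Z B.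
Proof.
move=> sZ sB BZ kerB; have sfB := subgroup_image sB.
have -> : cosets (f @` Z) (f @` B) = (fun c => f @` c) @` cosets Z B.
  apply/seteqP; split=> [_ [_ [z Zz <-] <-]|_ [_ [z Zz <-] <-]].
    by exists (coset B z); [exists z | rewrite image_coset].
  by rewrite image_coset; exists (f z) => //; exists z.
apply: inj_card_eq => _ _ /set_mem[x Zx <-] /set_mem[y Zy <-].
rewrite !image_coset => /(eq_coset _ _ sfB)[b Bb fb]; apply/eq_coset => //.
rewrite -[x - y](subrK b); apply: subgroupD => //; apply: kerB; split.
  by apply: sZ.2; [apply: sZ.2 | apply: BZ].
by rewrite /ker_set /= !raddfB fb subrr.
Qed.

Lemma coset_index_image Z B :
    subgroup Z -> subgroup B -> B `<=` Z -> Z `&` ker_set `<=` B ->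
  coset_index (f @` Z) (f @` B) = coset_index Z B.
Proof. by move=> *; apply: card_eq_fset_set; apply: cosets_image. Qed.

Lemma coset_index_range B : subgroup B ->
  coset_index (range f) (f @` B) =
  coset_index setT [set x + y | x in ker_set & y in B].
Proof.
move=> sB; have sK := subgroup_ker; have sKB := subgroup_add sK sB.
rewrite -(coset_index_image (@subgroupT V) sKB) //; last first.
  rewrite setTI => x kx; exists x => //.
  by exists 0; rewrite ?addr0 //; case: sB.
congr coset_index; apply/seteqP.
split=> [_ [y By <-]|_ [_ [x kx [y By <-]] <-]].
  by exists y => //; exists 0; [case: sK | exists y; rewrite ?add0r].
by exists y; rewrite // raddfD kx add0r.
Qed.

End CosetImage.

Lemma coset_index_ker_swap (V W W' : zmodType) (f : {additive V -> W})
    (g : {additive V -> W'}) :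
  coset_index (range f) (f @` ker_set g) =
  coset_index (range g) (g @` ker_set f).
Proof.
rewrite !coset_index_range; [|exact: subgroup_ker..]; congr coset_index.
by apply/seteqP; split=> _ [x xk [y yk <-]]; exists y => //; exists x;
  rewrite // addrC.
Qed.

(** * Kernels, images and supports *)

Section Supported.
Variable R : nzRingType.

Definition mxker p q (M : 'M[R]_(p, q)) : set 'cV[R]_q := [set u | M *m u = 0].

Definition mxim p q (M : 'M[R]_(p, q)) : set 'cV[R]_p := range (mulmx M).

Lemma subgroup_mxker p q (M : 'M[R]_(p, q)) : subgroup (mxker M).
Proof. exact: (subgroup_ker (mulmx M : {additive 'cV_q -> 'cV_p})). Qed.

Lemma subgroup_mxim p q (M : 'M[R]_(p, q)) : subgroup (mxim M).
Proof.
exact: (@subgroup_image _ _ (mulmx M : {additive 'cV_q -> 'cV_p}) setT).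
Qed.

Lemma image_mxim p q r (M : 'M[R]_(p, q)) (N : 'M[R]_(q, r)) :
  mulmx M @` mxim N = mxim (M *m N).
Proof.
apply/seteqP; split=> [_ [_ [u _ <-] <-]|_ [u _ <-]].
  by exists u; rewrite ?mulmxA.
by exists (N *m u); [exists u | rewrite mulmxA].
Qed.

Lemma image_rowsub_mxim p q r (f : 'I_r -> 'I_p) (M : 'M[R]_(p, q)) :
  rowsub f @` mxim M = mxim (rowsub f M).
Proof.
rewrite [in RHS]rowsubE -image_mxim; apply: eq_imagel => u _.
exact: rowsubE.
Qed.

Section Support.
Variables (m : nat) (J : {set 'I_m}).

Definition supported : set 'cV[R]_m :=
  [set u | forall j, u j 0 != 0 -> j \in J].

Definition inclusion_mx r (e : r = #|J|) : 'M[R]_(m, r) :=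
  colsub (enum_cast e) 1%:M.

Lemma mul_inclusion_mx p (M : 'M[R]_(p, m)) r (e : r = #|J|) :
  M *m inclusion_mx e = colsub (enum_cast e) M.
Proof. by rewrite mulmx_colsub mulmx1. Qed.

Lemma rowsub_inclusion_mx r (e : r = #|J|) (w : 'cV[R]_r) :
  rowsub (enum_cast e) (inclusion_mx e *m w) = w.
Proof.
rewrite -mul_rowsub_mx -[RHS]mul1mx; congr (_ *m _).
by apply/matrixP => k l; rewrite !mxE (inj_eq (@enum_cast_inj _ _ _ e)).
Qed.

Lemma inclusion_mx_inj r (e : r = #|J|) :
  injective (mulmx (inclusion_mx e) : 'cV[R]_r -> 'cV[R]_m).
Proof. exact: can_inj (rowsub_inclusion_mx e). Qed.

Lemma supported_inclusion_mx r (e : r = #|J|) w :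
  supported (inclusion_mx e *m w).
Proof.
move=> j; apply: contraNT => jJ; rewrite mxE big1 // => k _.
rewrite !mxE; case: eqP => [jk|_]; last by rewrite mul0r.
by rewrite jk enum_castP in jJ.
Qed.

Lemma supported_rowsub r (e : r = #|J|) u :
  supported u -> inclusion_mx e *m rowsub (enum_cast e) u = u.
Proof.
move=> uJ; apply/colP => j; case: (boolP (j \in J)) => [jJ|jNJ].
  have [k <-] := enum_cast_onto e jJ.
  have /colP/(_ k) := rowsub_inclusion_mx e (rowsub (enum_cast e) u).
  by rewrite !mxE.
have eq0 v : supported v -> v j 0 = 0.
  by move=> vJ; apply/eqP; apply: contraNT jNJ; apply: vJ.
by rewrite !eq0 //; apply: supported_inclusion_mx.
Qed.

Lemma supportedE r (e : r = #|J|) : supported = mxim (inclusion_mx e).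
Proof.
apply/seteqP; split=> [u uJ|_ [w _ <-]]; last exact: supported_inclusion_mx.
by exists (rowsub (enum_cast e) u) => //; apply: supported_rowsub.
Qed.

Lemma image_supported p (M : 'M[R]_(p, m)) r (e : r = #|J|) :
  mulmx M @` supported = mxim (colsub (enum_cast e) M).
Proof. by rewrite (supportedE e) image_mxim mul_inclusion_mx. Qed.

End Support.

Lemma supported_setC m (J : {set 'I_m}) r (e : r = #|J|) :
  supported (~: J) = [set u | rowsub (enum_cast e) u = 0].
Proof.
apply/seteqP; split=> [u uJ|u /colP u0 j].
  apply/colP => k; rewrite !mxE; apply/eqP; apply: contraT => /uJ.
  by rewrite inE enum_castP.
rewrite inE; apply: contraNN => /(enum_cast_onto e)[k <-].
by have := u0 k; rewrite !mxE => ->.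
Qed.

Lemma supported_setT m : supported [set: 'I_m]%SET = setT.
Proof. by apply/seteqP; split=> // u _ j; rewrite inE. Qed.

Lemma supported_set0 m : supported (finset.set0 : {set 'I_m}) = [set 0].
Proof.
apply/seteqP; split=> [u u0|_ -> j]; last by rewrite mxE eqxx.
by apply/colP => j; rewrite mxE; apply/eqP; apply: contraT => /u0; rewrite inE.
Qed.

End Supported.

(** * Indices of lattices *)

Lemma mxim_unit (R : comUnitRingType) r (M : 'M[R]_r) :
  M \in unitmx -> mxim M = setT.
Proof.
move=> uM; apply/seteqP; split=> // u _.
by exists (invmx M *m u) => //; rewrite mulKVmx.
Qed.

Lemma card_fset_setT (I : finType) : #|` fset_set [set: I]| = #|I|.
Proof.
rewrite -(card_finset predT); congr (#|` _|); apply/fsetP => i.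
by rewrite (in_fset_set finite_finset) in_fset mem_setT.
Qed.

Lemma coset_index_diag r (d : 'rV[int]_r) : (forall i, d 0 i != 0) ->
  coset_index setT (mxim (diag_mx d)) = (\prod_i `|d 0%R i|)%N.
Proof.
move=> d0; have sB := subgroup_mxim (diag_mx d); set B := mxim _ in sB *.
pose I : finType := {dffun forall i, 'I_`|d 0%R i|%N}.
pose residue (g : I) := coset B (\col_i (g i : nat)%:Z).
have -> : (\prod_i `|d 0%R i|)%N = #|I|.
  rewrite card_dep_ffun foldrE big_map big_enum.
  by apply: eq_bigr => i _; rewrite card_ord.
have residue_inj : {in setT &, injective residue}.
  move=> g h _ _ /(eq_coset _ _ sB)[u _ /colP gh]; apply/ffunP => i.
  apply: val_inj; have := gh i; rewrite mul_diag_mx !mxE => gh_i.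
  have : (g i = h i %[mod d 0%R i])%Z.
    by apply/eqP; rewrite eqz_mod_dvd -gh_i dvdz_mulr.
  have small (k : 'I_`|d 0%R i|%N) : (k%:Z %% d 0%R i)%Z = k%:Z.
    by rewrite -modz_abs modz_small //= ltz_nat ltn_ord.
  by rewrite !small => -[].
rewrite -card_fset_setT -(card_eq_fset_set (inj_card_eq residue_inj)).
congr (#|` fset_set _|); apply/seteqP.
split=> [_ [z _ <-]|_ [g _ <-]]; last by eexists; last reflexivity.
have mod_lt i : (`|(z i 0%R %% d 0%R i)%Z| < `|d 0%R i|)%N.
  by rewrite -ltz_nat gez0_abs ?modz_ge0 //; apply: ltz_mod.
exists [ffun i => Ordinal (mod_lt i)] => //; apply/eq_coset => //.
exists (- \col_i (z i 0%R %/ d 0%R i)%Z) => //.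
apply/colP => i; rewrite mul_diag_mx !mxE ffunE /= gez0_abs ?modz_ge0 //.
rewrite [X in _ - X](divz_eq (z i 0) (d 0 i)) opprD addrCA subrr addr0.
by rewrite mulrN mulrC.
Qed.

Lemma absz_det_unit r (L : 'M[int]_r) : L \in unitmx -> `|\det L|%N = 1%N.
Proof. by rewrite unitmxE => /orP[] /eqP ->. Qed.

Lemma coset_index_det r (M : 'M[int]_r) : \det M != 0 ->
  coset_index setT (mxim M) = `|\det M|%N.
Proof.
have [L uL [N uN [d _ ->]]] := int_Smith_normal_form M.
have -> : \matrix_(i, j) (d`_i *+ (i == j :> nat)) =
    diag_mx (\row_(i < r) d`_i).
  by apply/matrixP => i j; rewrite !mxE.
set D := diag_mx _; rewrite !det_mulmx !abszM.
rewrite (absz_det_unit uL) (absz_det_unit uN) mul1n muln1 det_diag.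
rewrite !mulf_eq0 !negb_or => /andP[/andP[_ /prodf_neq0 d0] _].
have -> : mxim (L *m D *m N) = mulmx L @` mxim D.
  by rewrite -mulmxA -image_mxim -[mxim (D *m N)]image_mxim (mxim_unit uN).
rewrite -[X in coset_index X _](mxim_unit uL).
pose mulL : {additive 'cV[int]_r -> 'cV[int]_r} := mulmx L.
rewrite (coset_index_image (f := mulL)) //; first last.
- move=> u [_ /(congr1 (mulmx (invmx L)))].
  by rewrite /mulL /= mulKmx // mulmx0 => ->; case: (subgroup_mxim D).
- exact: subgroup_mxim.
rewrite coset_index_diag => [|i].
  rewrite (big_morph absz abszM (erefl _)).
  by apply: eq_bigr => i _; rewrite mxE.
exact: d0.
Qed.

Lemma finite_cosets_rank_dom (A : numDomainType) n m k (D : 'M[A]_(n, m))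
    (E : 'M[A]_(n, k)) :
  finite_set (cosets (mxim D) (mxim E)) -> (rank_dom D <= rank_dom E)%N.
Proof.
move=> fin.
have colD j : exists cw : nat * 'cV[A]_k,
    (0 < cw.1)%N /\ E *m cw.2 = col j D *+ cw.1.
  have [|c c0 [w _ Ew]] :=
      finite_cosets_mulrn (x := col j D) (subgroup_mxim E) fin.
    move=> l; exists (delta_mx j 0 *+ l) => //.
    by rewrite -!scaler_nat -scalemxAr -colE.
  by exists (c, w).
have [cw cwD] := fin_all_exists colD.
pose c : 'rV[A]_m := \row_j (cw j).1%:R; pose W := \matrix_(i, j) (cw j).2 i 0.
have DcEW : D *m diag_mx c = E *m W.
  apply/matrixP => i j; rewrite mul_mx_diag !mxE.
  have /colP/(_ i) := (cwD j).2; rewrite mulmxnE !mxE mulr_natr => <-.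
  by apply: eq_bigr => l _; rewrite !mxE.
have [I [J [<- M0]]] := exists_minor_neq0 D.
apply: leq_trans (rank_domM_maxl E W); rewrite -DcEW.
apply: (@minor_neq0_leq_rank _ _ _ _ J); rewrite minor_mul_diag mulf_neq0 //.
by apply/prodf_neq0 => j _; rewrite mxE pnatr_eq0 -lt0n; case: (cwD j).
Qed.

(** * Column bases and exact pairs *)

Section Columns.
Variables (A : idomainType) (n m : nat) (D : 'M[A]_(n, m)).
Implicit Type J : {set 'I_m}.

Definition col_free J : Prop := forall u, supported J u -> D *m u = 0 -> u = 0.

Definition col_basis J : Prop := col_free J /\ #|J| = rank_dom D.

Lemma col_freeP J r (e : r = #|J|) :
  col_free J <-> rank_dom (colsub (enum_cast e) D) = r.
Proof.
rewrite -mul_inclusion_mx -rank_dom_injP; split=> [free w|inj u uJ].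
  rewrite -mulmxA => Dw; apply: (inclusion_mx_inj (e := e)); rewrite mulmx0.
  by apply: free Dw; apply: supported_inclusion_mx.
by rewrite -(supported_rowsub e uJ) mulmxA => /inj->; rewrite mulmx0.
Qed.

Lemma minor_neq0_col_free (I : {set 'I_n}) J : minor I J D != 0 -> col_free J.
Proof.
move=> M0; have e := minor_card_eq M0; move: M0; rewrite (minorE _ erefl e).
rewrite -rank_dom_det => /eqP rM; apply/(col_freeP e)/eqP.
by rewrite eqn_leq rank_leq_col -{1}rM mxsubrc rank_dom_mxsub.
Qed.

End Columns.

Definition exact_mx (R : nzRingType) p n m (A : 'M[R]_(p, n))
  (D : 'M[R]_(n, m)) : Prop := mxker A = mxim D.

Lemma exact_mulmx (R : nzRingType) p n m (A : 'M[R]_(p, n))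
    (D : 'M[R]_(n, m)) :
  exact_mx A D -> A *m D = 0.
Proof.
move=> AD; apply/matrixP => i j.
have : mxker A (col j D) by rewrite AD; exists (delta_mx j 0); rewrite // colE.
by rewrite /mxker /= colE mulmxA -colE => /colP/(_ i); rewrite !mxE.
Qed.

Section ExactPair.
Variables (R : idomainType) (p n m : nat) (A : 'M[R]_(p, n)) (D : 'M[R]_(n, m)).
Hypothesis exactAD : exact_mx A D.

Lemma rank_dom_exact : (rank_dom A + rank_dom D = n)%N.
Proof.
rewrite /rank_dom; set toF := @FracField.tofrac R.
set A' := map_mx toF A; set D' := map_mx toF D.
suff -> : \rank D' = \rank (kermx A'^T).
  by rewrite mxrank_ker mxrank_tr subnKC // rank_leq_col.
rewrite -mxrank_tr; apply: eqmx_rank; apply/andP; split.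
  apply/sub_kermxP; rewrite -trmx_mul -map_mxM (exact_mulmx exactAD).
  by rewrite map_mx0 trmx0.
apply/rV_subP => v /sub_kermxP vA.
have [|c [w [c0 Aw wv]]] := @clear_denominators_ker _ _ _ A v^T.
  by apply: trmx_inj; rewrite trmx_mul trmxK trmx0.
have [u _ Du] : mxim D w by rewrite -exactAD.
apply/submxP; exists ((toF c)^-1 *: (map_mx toF u)^T).
rewrite -scalemxAl -trmx_mul -map_mxM Du wv linearZ /= trmxK scalerA mulVf.
  by rewrite scale1r.
by rewrite tofrac_eq0.
Qed.

Lemma card_setC_rank_dom (I : {set 'I_n}) :
  (#|I| == rank_dom D) = (#|(~: I)%SET| == rank_dom A).
Proof.
have rank_cards : (rank_dom A + rank_dom D = #|I| + #|(~: I)%SET|)%N.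
  by rewrite rank_dom_exact cardsC card_ord.
by rewrite -(eqn_add2l (rank_dom A)) rank_cards addnC eqn_add2l eq_sym.
Qed.

Lemma minor_neq0_col_basis (I : {set 'I_n}) (J : {set 'I_m}) :
  #|I| = rank_dom D /\ minor I J D != 0 <-> col_basis A (~: I) /\ col_basis D J.
Proof.
split=> [[rI M0]|[[freeA rIC] [freeD rJ]]].
  have e := minor_card_eq M0; split; split; rewrite -?e //.
  - move=> u; rewrite (supported_setC _ erefl) => uI Au.
    have [v _ Dv] : mxim D u by rewrite -exactAD.
    rewrite -Dv in uI *; apply: rowsub_mul_eq0 uI; apply/eqP.
    rewrite eqn_leq rank_dom_mxsub -rI /=.
    move: M0; rewrite (minorE _ erefl e) -rank_dom_det => /eqP {1}<-.
    by rewrite mxsubcr rank_dom_mxsub.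
  - by apply/eqP; rewrite -card_setC_rank_dom rI.
  - exact: minor_neq0_col_free M0.
have rI : #|I| = rank_dom D by apply/eqP; rewrite card_setC_rank_dom rIC.
split=> //; have e : #|I| = #|J| by rewrite rI rJ.
rewrite (minorE _ erefl e) -rank_dom_det; apply/eqP/rank_dom_injP => w.
rewrite mxsubrc -mul_inclusion_mx mul_rowsub_mx -mulmxA => Dw.
apply: (inclusion_mx_inj (e := e)); rewrite mulmx0.
apply: freeD; first exact: supported_inclusion_mx.
apply: freeA; last by rewrite (mulmxA A) (exact_mulmx exactAD) mul0mx.
by rewrite (supported_setC _ erefl).
Qed.

End ExactPair.

(* Projecting to the rows [I] identifies [ker A / D Z^J] with [L / D_I Z^J],
   where [L] is the projection of [ker A], and [A] identifies [Z^I / L] with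
   [im A / A Z^(~ I)]. *)
Lemma coset_index_minor p n m (A : 'M[int]_(p, n)) (D : 'M[int]_(n, m))
    (I : {set 'I_n}) (J : {set 'I_m}) :
    exact_mx A D -> col_basis A (~: I) -> col_basis D J ->
  (coset_index (mxim A) (mulmx A @` supported (~: I)) *
   coset_index (mxker A) (mulmx D @` supported J) = `|minor I J D|)%N.
Proof.
move=> exactAD basisA basisD.
have [rI M0] := (minor_neq0_col_basis exactAD I J).2 (conj basisA basisD).
have e := minor_card_eq M0; rewrite (minorE _ erefl e) in M0 *.
pose proj : {additive 'cV[int]_n -> 'cV[int]_#|I|} := rowsub (enum_cast erefl).
pose mulA : {additive 'cV[int]_n -> 'cV[int]_p} := mulmx A.
have ker_proj : ker_set proj = supported (~: I).
  by rewrite (supported_setC _ erefl).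
have proj_onto : range proj = setT.
  apply/seteqP; split=> // w _; exists (inclusion_mx _ erefl *m w) => //.
  exact: rowsub_inclusion_mx.
have sub_ker : mulmx D @` supported J `<=` mxker A.
  by move=> _ [u _ <-]; rewrite /mxker /= mulmxA (exact_mulmx exactAD) mul0mx.
have sDJ : subgroup (mulmx D @` supported J).
  by rewrite (image_supported _ erefl); apply: subgroup_mxim.
rewrite -(coset_index_det M0) -ker_proj.
rewrite -(coset_index_ker_swap proj mulA) proj_onto.
rewrite -(coset_index_image (f := proj) (subgroup_mxker A) sDJ sub_ker).
  rewrite -coset_index_tower //; last exact: image_subset.
  - by rewrite (image_supported _ e) image_rowsub_mxim -mxsubrc.
  - exact: subgroup_image (subgroup_mxker A).
  - exact: subgroup_image.
rewrite ker_proj => v [Av vI]; rewrite (basisA.1 v vI Av); exact: sDJ.1.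
Qed.

(** * Trees of a finite CW-complex *)

Section Trees.
Variables (R : realType) (S : finCW R) (C : cellular_chains S).
Local Notation boundary j := (boundary_mx C (j - 1) j).

Lemma subcomplex_between_skeletons (j : int) (T : {set acell S}) :
  skeleton S (j - 1) \subset T -> T \subset skeleton S j -> subcomplex T.
Proof.
move=> /fintype.subsetP sT /fintype.subsetP Ts c cT.
have := Ts _ cT; rewrite inE /= => cj; split.
  by apply: sT; rewrite inE /= lerBrDr addNr (le_trans _ cj).
move=> _ [x dx <-]; have := dx; rewrite /disc /= le_eqVlt => /orP[/eqP sx|ox].
  have [b bc ob] := @cw_attach R S c x sx; exists b => //=.
  by apply: sT; rewrite inE /= lerBrDr (le_trans _ cj) // lezD1 ltz_nat.
by exists c => //; exists x.
Qed.

Lemma adim_enum_val j (a : 'I_#|cells S j|) : adim (enum_val a) = j.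
Proof. by have := enum_valP a; rewrite inE => /eqP. Qed.

Lemma adim_geN1 (c : acell S) : - 1 <= adim c.
Proof. by case: c. Qed.

Definition cellset (j : int) (T : {set acell S}) : {set 'I_#|cells S j|} :=
  [set a | enum_val a \in T]%SET.

Lemma chainsE T j : chains T j = supported (cellset j T).
Proof. by apply/seteqP; split=> z zT a /zT; rewrite inE. Qed.

Lemma card_cellset j T : #|T :&: cells S j| = #|cellset j T|.
Proof.
rewrite -(card_imset _ (@enum_val_inj _ (mem (cells S j)))).
apply: eq_card => c; rewrite inE; apply/andP/imsetP => [[cT cj]|[a]].
  by exists (enum_rank_in cj c); rewrite ?inE enum_rankK_in.
by rewrite inE => aT ->; rewrite aT enum_valP.
Qed.

Lemma cellset_skeleton (k j : int) (T : {set acell S}) :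
  skeleton S j \subset T -> k <= j -> cellset k T = [set: 'I_#|cells S k|]%SET.
Proof.
move=> /fintype.subsetP sT kj; apply/setP => a; rewrite !inE; apply: sT.
by rewrite inE adim_enum_val.
Qed.

Lemma cellset_above (k j : int) (T : {set acell S}) :
  T \subset skeleton S j -> j < k -> cellset k T = finset.set0.
Proof.
move=> /fintype.subsetP Ts jk; apply/setP => a; rewrite !inE.
by apply: contraTF jk => /Ts; rewrite inE adim_enum_val -leNgt.
Qed.

(* [j - 1 + 1] and [j] are not convertible, so that matrices indexed by cells of
   these dimensions have distinct types. *)
Lemma boundaries_pred T (j : int) :
  boundaries C T (j - 1) = mulmx (boundary j) @` supported (cellset j T).
Proof.
rewrite /boundaries -chainsE.
have : j - 1 + 1 = j by rewrite subrK.
by move: (j - 1 + 1) => l ->.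
Qed.

Lemma mul_boundary (j : int) : boundary (j - 1) *m boundary j = 0.
Proof.
have := incidence_boundary C (j - 1); rewrite -/(boundary_mx C _ _).
have : j - 1 + 1 = j by rewrite subrK.
by move: (j - 1 + 1) => l ->.
Qed.

Lemma subgroup_boundaries T j : subgroup (boundaries C T j).
Proof.
rewrite /boundaries chainsE (image_supported _ erefl); exact: subgroup_mxim.
Qed.

Lemma homology0P T j : homology0 C T j <-> cycles C T j `<=` boundaries C T j.
Proof.
have sB := subgroup_boundaries T j; split=> [h0 z Zz|ZB].
  have : homology C T j (coset (boundaries C T j) z) by exists z.
  by rewrite h0 => /(coset_id _ sB).
apply/seteqP; split=> [_ [z /ZB Bz <-]|_ ->]; first exact/coset_id.
exists 0; last exact: coset0.
by split; [move=> a; rewrite mxE eqxx | rewrite mulmx0].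
Qed.

Lemma acyclic_exact (j k : int) : acyclic C k -> j - 1 <= k ->
  exact_mx (boundary (j - 1)) (boundary j).
Proof.
move=> acC jk; apply/seteqP; split=> [z dz|_ [u _ <-]]; last first.
  by rewrite /mxker /= mulmxA mul_boundary mul0mx.
case: (lerP (- 1) (j - 1)) => [j_ge|j_lt].
  have /homology0P ZB := acC (j - 1) (introT andP (conj j_ge jk)).
  have : cycles C [set: acell S]%SET (j - 1) z by split=> // a _; rewrite inE.
  by move=> /ZB; rewrite boundaries_pred => -[u _ <-]; exists u.
exists 0; rewrite // mulmx0; apply/colP => a.
by have := adim_geN1 (enum_val a); rewrite adim_enum_val leNgt j_lt.
Qed.

Lemma homology_cosets (T : {set acell S}) (j : int) :
    skeleton S (j - 1) \subset T ->
  homology C T (j - 1) = cosets (mxker (boundary (j - 1)))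
    (mulmx (boundary j) @` supported (cellset j T)).
Proof.
move=> sT; rewrite /homology boundaries_pred -[LHS]/(cosets _ _); congr cosets.
apply/seteqP; split=> [v [] //|v Av]; split=> //.
by rewrite chainsE (cellset_skeleton sT) // supported_setT.
Qed.

Lemma homology0_col_free (T : {set acell S}) (j : int) :
    T \subset skeleton S j ->
  homology0 C T j <-> col_free (boundary j) (cellset j T).
Proof.
move=> Ts; rewrite homology0P /boundaries chainsE (cellset_above Ts) ?ltrDl //.
rewrite supported_set0 image_set1 mulmx0 /cycles chainsE.
by split=> [ZB u uT du|free z [zT dz]]; [apply: ZB | apply: free].
Qed.

Lemma is_treeP (T : {set acell S}) (j : int) :
  is_tree C j T <->
  [/\ skeleton S (j - 1) \subset T, T \subset skeleton S j &
      col_basis (boundary j) (cellset j T)].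
Proof.
rewrite /is_tree card_cellset /=; set D := boundary j; set J := cellset j T.
split=> [[_ sT Ts]|[sT Ts [freeJ cJ]]]; last first.
  split=> //; first exact: subcomplex_between_skeletons Ts.
  by apply: Or32; split=> //; apply/homology0_col_free.
pose DJ := colsub (enum_cast (erefl #|J|)) D.
have free_rank : homology0 C T j <-> rank_dom DJ = #|J|.
  exact: iff_trans (homology0_col_free Ts) (col_freeP D erefl).
have finite_rank :
    finite_set (homology C T (j - 1)) -> rank_dom DJ = rank_dom D.
  rewrite (homology_cosets sT) (image_supported _ erefl) => fin; apply/eqP.
  rewrite eqn_leq rank_dom_mxsub finite_cosets_rank_dom //.
  apply: sub_finite_set fin => _ [_ [u _ <-] <-]; exists (D *m u) => //.
  by rewrite /mxker /= mulmxA mul_boundary mul0mx.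
have rank_basis : rank_dom DJ = #|J| -> #|J| = rank_dom D -> col_basis D J.
  by move=> rJ cJ; split=> //; apply/(col_freeP D erefl).
case=> [[/free_rank rJ /finite_rank rD]|[/free_rank rJ cJ]|
        [/finite_rank rD cJ]]; split=> //; apply: rank_basis => //.
- by rewrite -rJ.
- by rewrite rD.
Qed.

Definition spanning_complex (j : int) (J : {set 'I_#|cells S j|}) :
    {set acell S} :=
  skeleton S (j - 1) :|: [set enum_val a | a in J]%SET.

Lemma spanning_complex_skeleton j (J : {set 'I_#|cells S j|}) :
  skeleton S (j - 1) \subset spanning_complex J.
Proof. exact: finset.subsetUl. Qed.

Lemma spanning_complex_sub j (J : {set 'I_#|cells S j|}) :
  spanning_complex J \subset skeleton S j.
Proof.
apply/fintype.subsetP => c; rewrite finset.in_setU => /orP[|/imsetP[a _ ->]].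
  by rewrite !inE => /le_trans; apply; rewrite gerBl.
by rewrite inE adim_enum_val.
Qed.

Lemma cellset_spanning_complex j (J : {set 'I_#|cells S j|}) :
  cellset j (spanning_complex J) = J.
Proof.
apply/setP => a; rewrite !inE adim_enum_val lerBrDl gerDr.
exact: mem_imset enum_val_inj.
Qed.

Lemma spanning_complex_cellset j (T : {set acell S}) :
  skeleton S (j - 1) \subset T -> T \subset skeleton S j ->
  spanning_complex (cellset j T) = T.
Proof.
move=> /fintype.subsetP sT /fintype.subsetP Ts; apply/setP => c.
rewrite finset.in_setU; apply/orP/idP => [[/sT //|/imsetP[a]]|cT].
  by rewrite inE => aT ->.
have := Ts _ cT; rewrite inE le_eqVlt => /orP[cj|cj]; last first.
  by left; rewrite inE lerBrDr lezD1.
have cJ : c \in cells S j by rewrite inE.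
by right; apply/imsetP; exists (enum_rank_in cJ c); rewrite ?inE enum_rankK_in.
Qed.

Lemma wtree_enumE j (K : comNzRingType) (w : 'rV[K]_#|cells S j|) :
  wtree_enum C j w =
  \sum_(J : {set 'I_#|cells S j|} | `[< col_basis (boundary j) J >])
    (\prod_(a in J) w 0 a) *
      (coset_index (mxker (boundary (j - 1)))
         (mulmx (boundary j) @` supported J) ^ 2)%N%:R.
Proof.
rewrite /wtree_enum.
rewrite (reindex_onto (@spanning_complex j) (cellset j)) /=; last first.
  by move=> T /asboolP/is_treeP[sT Ts _]; apply: spanning_complex_cellset.
apply: eq_big => [J|J _].
  rewrite cellset_spanning_complex eqxx andbT; apply/asboolP/asboolP.
    by move=> /is_treeP[_ _]; rewrite cellset_spanning_complex.
  move=> basisJ; apply/is_treeP; rewrite cellset_spanning_complex.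
  by split=> //;
    [exact: spanning_complex_skeleton | exact: spanning_complex_sub].
rewrite /homology_card homology_cosets ?spanning_complex_skeleton //.
rewrite cellset_spanning_complex; congr (_ * _); apply: eq_bigl => a.
by rewrite -[in RHS](cellset_spanning_complex J) [RHS]inE.
Qed.

Lemma tree_enumE j : (tree_enum C j)%:Z = wtree_enum C j (const_mx 1).
Proof.
rewrite /tree_enum /wtree_enum -natz natr_sum; apply: eq_bigr => T _.
by rewrite big1 ?mul1r // => a _; rewrite mxE.
Qed.

Section Product.
Variable i : int.
Hypotheses (exact_boundary : exact_mx (boundary (i - 1)) (boundary i))
  (exact_boundary_pred : exact_mx (boundary (i - 1 - 1)) (boundary (i - 1))).
Let D := boundary i.

Lemma wtree_enum_mul (K : comNzRingType) (w : 'rV[K]_#|cells S (i - 1)|)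
    (y : 'rV[K]_#|cells S i|) :
  wtree_enum C (i - 1) w * wtree_enum C i y =
  \sum_(I : {set 'I_#|cells S (i - 1)|} | #|I| == rank_dom D)
    \sum_(J : {set 'I_#|cells S i|} | #|J| == #|I|)
      (\prod_(a in (~: I)%SET) w 0 a) *
      ((\prod_(a in J) y 0 a) * minor I J (map_mx intr D) ^+ 2).
Proof.
rewrite !wtree_enumE big_distrlr /= (reindex_inj (@finset.setC_inj _)) /=.
rewrite pair_big pair_big_dep /=.
rewrite [RHS](bigID (fun IJ => minor IJ.1 IJ.2 D != 0)) /= [X in _ = _ + X]big1.
  rewrite addr0; apply: eq_big => [[I J]|[I J]] /=.
    apply/andP/andP => [[/asboolP bI /asboolP bJ]|[/andP[/eqP rI _] M0]].
      have [rI M0] := (minor_neq0_col_basis exact_boundary I J).2 (conj bI bJ).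
      by rewrite -(minor_card_eq M0) rI !eqxx.
    have [bI bJ] := (minor_neq0_col_basis exact_boundary I J).1 (conj rI M0).
    by split; apply/asboolP.
  move=> /andP[/asboolP bI /asboolP bJ].
  rewrite mulrACA -mulrA; congr (_ * (_ * _)).
  rewrite exact_boundary_pred.
  rewrite -natrM -expnMn coset_index_minor // minor_map -rmorphXn pmulrn.
  by congr (_ %:~R); rewrite -natz natrX natz abszE real_normK ?num_real.
move=> [I J] /andP[_ /negPn/eqP /= M0].
by rewrite minor_map M0 rmorph0 expr0n /= !mulr0.
Qed.

Lemma pdet_weighted_laplacian (K : idomainType)
    (x s xinv : 'rV[K]_#|cells S (i - 1)|) (y : 'rV[K]_#|cells S i|) :
    (forall a, s 0 a ^+ 2 = x 0 a) -> (forall a, x 0 a * xinv 0 a = 1) ->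
    (forall I J, minor I J D != 0 -> gram_minor x y I (map_mx intr D) != 0) ->
  pdet (weighted_gram s y (map_mx intr D)) =
  (\prod_a x 0 a) * wtree_enum C (i - 1) xinv * wtree_enum C i y.
Proof.
move=> sx xK gram_neq0; rewrite pdetE rank_dom_weighted_gram; last first.
  by move=> I J /gram_neq0; rewrite (minor_weighted_gram _ _ _ sx).
rewrite -mulrA wtree_enum_mul mulr_sumr; apply: eq_bigr => I _.
rewrite (minor_weighted_gram _ _ _ sx) -mulr_sumr /gram_minor mulrA.
congr (_ * _).
rewrite [in RHS](bigID (mem I)) /= -mulrA -[LHS]mulr1; congr (_ * _).
under [X in _ = _ * X]eq_bigl do rewrite finset.in_setC.
by rewrite -big_split big1 // => a _; apply: xK.
Qed.

End Product.
End Trees.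

Theorem theorem5p3 (R : realType) (S : finCW R) (C : cellular_chains S)
    (i : nat) (Sacyclic : acyclic C (i%:Z - 1)) :
  let n := #|cells S (i%:Z - 1)| in
  let m := #|cells S i%:Z| in
  let D : 'M[int]_(n, m) := boundary_mx C (i%:Z - 1) i%:Z in
  pdet (D *m D^T) = (tree_enum C (i%:Z - 1)%R * tree_enum C i%:Z)%N%:Z /\
  forall (F : fieldType) (iota : {rmorphism ratfun (n + m) -> F})
         (sqrtx : 'rV[F]_n),
    let x : 'rV[F]_n := \row_j iota (indet (lshift m j)) in
    let y : 'rV[F]_m := \row_j iota (indet (rshift n j)) in
    (forall j, sqrtx 0 j ^+ 2 = x 0 j) ->
    let D' : 'M[F]_(n, m) := map_mx intr D in
    let L := diag_mx sqrtx *m D' *m diag_mx y *m D'^T *m diag_mx sqrtx in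
    pdet L = (\prod_j x 0 j) *
             wtree_enum C (i%:Z - 1) (\row_j (x 0 j)^-1) *
             wtree_enum C i%:Z y.
Proof.
move=> n m D.
have exact_boundary := acyclic_exact Sacyclic (lexx _).
have le_pred : i%:Z - 1 - 1 <= i%:Z - 1 by rewrite gerBl.
have exact_boundary_pred := acyclic_exact Sacyclic le_pred.
split=> [|F iota sqrtx x y sqrtxK D' L].
  have mapD : map_mx intr D = D by apply/matrixP => a b; rewrite mxE intz.
  have -> : D *m D^T = weighted_gram (const_mx 1) (const_mx 1) (map_mx intr D).
    by rewrite mapD /weighted_gram !diag_const_mx mul1mx !mulmx1.
  rewrite (pdet_weighted_laplacian exact_boundary exact_boundary_pred
    (x := const_mx 1) (xinv := const_mx 1)) => [|a|a|I J M0];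
    rewrite ?mxE ?expr1n ?mulr1 //.
    by rewrite big1 ?mul1r ?PoszM ?tree_enumE // => a _; rewrite mxE.
  by rewrite mapD; apply: gram_minor1_neq0 M0.
apply: (pdet_weighted_laplacian exact_boundary exact_boundary_pred) => //.
  by move=> a; rewrite !mxE divff // IndeterminateWeights.iota_indet_neq0.
by move=> I J; apply: IndeterminateWeights.gram_minor_indet_neq0.
Qed.
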